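(* Every MPC algorithm for $\mathsf{ExpanderConn}_n$ with $s$ space per machine (and an arbitrary number of machines) requires $r=\Omega(\log_s n)$ rounds of computation. This holds even for randomized MPC protocols with constant error probability.
   Context: $\mathsf{ExpanderConn}_n$ is the following decision promise problem. The input is an $n$-vertex undirected graph $G$, and the task is to decide whether $G$ is connected. The promise is that $|E(G)| = O(n)$ and that every connected component of $G$ has spectral gap $\Omega(1)$, where the hidden constants are fixed. The spectral gap of a graph is the second smallest eigenvalue $\lambda_2$ of its normalized Laplacian $I - D^{-1/2}AD^{-1/2}$. MPC model: the input is distributed across machines with local memory $s$. Computation proceeds in synchronous rounds with arbitrary local computation. Between rounds, each machine sends and receives in total at most $s$. *)

(* Defs.v *)
From HB Require Import structures.
From mathcomp Require Import all_boot all_order all_algebra.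
From mathcomp Require Import reals exp.

Set Implicit Arguments.
Unset Strict Implicit.
Unset Printing Implicit Defensive.

Import Order.TTheory GRing.Theory Num.Theory.

Local Open Scope ring_scope.

Record sgraph (T : finType) := SGraph {
  adj :> rel T;
  adj_sym : symmetric adj;
  adj_irr : irreflexive adj }.

Section Graphs.
Variable T : finType.
Implicit Types (G : sgraph T).

Definition edge_set G : {set {set T}} :=
  [set e : {set T} | [exists x, exists y, adj G x y && (e == [set x; y])]].

Definition connected G : bool := [forall x, forall y, connect (adj G) x y].

Definition component G (x : T) : {set T} := [set y | connect (adj G) x y].

Section Laplacian.
Variables (R : realType) (G : sgraph T) (H : {set T}).

(* The rows and columns of these matrices are indexed by the vertices of the
   subgraph of G induced by H, through enum_val. *)
Definition adj_mx : 'M[R]_#|H| :=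
  \matrix_(i, j) (adj G (enum_val i) (enum_val j))%:R.

Definition degree (x : T) : nat := #|[set y in H | adj G x y]|.

(* D^(-1/2); an isolated vertex gets the entry 0, since 0^-1 = 0. *)
Definition inv_sqrt_deg_mx : 'M[R]_#|H| :=
  diag_mx (\row_i (Num.sqrt (degree (enum_val i))%:R)^-1).

Definition normalized_laplacian : 'M[R]_#|H| :=
  1%:M - inv_sqrt_deg_mx *m adj_mx *m inv_sqrt_deg_mx.

End Laplacian.
End Graphs.

(* s lists the eigenvalues of A, with multiplicity, in nondecreasing order. *)
Definition is_spectrum (R : realType) (k : nat) (A : 'M[R]_k) (s : seq R) :=
  sorted <=%R s /\ char_poly A = \prod_(z <- s) ('X - z%:P).

(* A one-vertex subgraph has no second eigenvalue, hence no spectral gap. *)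
Definition is_spectral_gap (R : realType) (T : finType) (G : sgraph T)
    (H : {set T}) (g : R) :=
  exists s : seq R, [/\ is_spectrum (normalized_laplacian R G H) s,
    (1 < size s)%N & g = s`_1].

Definition expander_conn_promise (R : realType) (n : nat) (C gamma : R)
    (G : sgraph 'I_n) :=
  #|edge_set G|%:R <= C * n%:R /\
  forall x : 'I_n, exists2 g : R,
    is_spectral_gap G (component G x) g & gamma <= g.

(* A randomized MPC protocol whose input is a list of items of type I.
   - Space is counted in words.  The word type is part of the protocol and its
     size is not restricted.  An input item is stored as one word.
   - The machine that initially holds an input item may depend on the item and
     on its position in the list, but on nothing else in the input.
   - The protocol is a finite mixture, with weights mass, of deterministic
     protocols.  All machines see the same random outcome; private coins are
     the case of a product space.
   - keep and send are the local computation of round t: from the memory of a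
     machine they give the words it retains and the words it sends, each with
     its destination. *)
Record mpc (R : realType) (I : Type) := MPC {
  machine : finType;
  word : finType;
  coins : finType;
  mass : coins -> R;
  mass_ge0 : forall w, 0 <= mass w;
  mass_sum1 : \sum_w mass w = 1;
  place : nat -> I -> machine;
  load : nat -> I -> word;
  keep : nat -> coins -> machine -> seq word -> seq word;
  send : nat -> coins -> machine -> seq word -> seq (machine * word);
  out_machine : machine;
  out : coins -> seq word -> bool }.

Section Execution.
Variables (R : realType) (I : Type) (A : mpc R I).
Variables (w : coins A) (input : seq I).

Definition init_memory (i : machine A) : seq (word A) :=
  [seq load A p.1 p.2 | p <- zip (iota 0 (size input)) input
                      & place A p.1 p.2 == i].

Definition inbox (t : nat) (mem : machine A -> seq (word A)) (i : machine A) :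
    seq (word A) :=
  flatten [seq [seq m.2 | m <- send t w k (mem k) & m.1 == i]
          | k <- enum (machine A)].

(* The memory of each machine at the beginning of round t (t = 0, 1, ...). *)
Fixpoint memory (t : nat) : machine A -> seq (word A) :=
  if t is t'.+1 then
    fun i => keep t' w i (memory t' i) ++ inbox t' (memory t') i
  else init_memory.

(* Space bound for r rounds of computation, hence r - 1 communication phases.
   The numbers of words sent and received are bounded separately, which is
   weaker than bounding their sum. *)
Definition within_space (s r : nat) :=
  forall i : machine A,
    (forall t, (t < r)%N -> (size (memory t i) <= s)%N) /\
    (forall t, (t.+1 < r)%N -> (size (send t w i (memory t i)) <= s)%N /\
                               (size (inbox t (memory t) i) <= s)%N).

(* The answer is computed locally by out_machine in the last of r > 0 rounds. *)
Definition answer (r : nat) : bool := out w (memory r.-1 (out_machine A)).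

End Execution.

(* The input list is any enumeration of the edges of G.  Both the space bound
   and the correctness are required only on graphs satisfying the promise. *)
Definition solves_expander_conn (R : realType) (n : nat) (C gamma eps : R)
    (s r : nat) (A : mpc R {set 'I_n}) :=
  forall (G : sgraph 'I_n) (l : seq {set 'I_n}),
    expander_conn_promise C gamma G -> perm_eq l (enum (edge_set G)) ->
    (forall w : coins A, within_space w l s r) /\
    \sum_(w : coins A | answer w l r != connected G) mass w <= eps.

(* Main.v *)
(* Polynomial method on a family of promise graphs encoding AND. A hub and
   K ~ n/3 gadgets of three vertices are given, and Z is the set of detached
   gadgets. A gadget in Z is a triangle; every vertex outside the detached
   gadgets is a leaf attached to the hub. The components are a star and
   triangles, with spectral gaps at least 1, and the graph is connected iff Z is
   empty. Each non-hub vertex owns one position of the edge list, whose edge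
   depends only on whether the gadget of that vertex belongs to Z. As at most s
   words reach a machine in a round, one round multiplies the degree in Z of any
   function of a memory by at most s + 1, so the acceptance probability is a
   polynomial of degree d <= s (s + 1)^(r - 1) that approximates [Z = empty].
   Averaging over |Z| = u gives a univariate Q of degree at most d, with values
   in [0, eps] at u = 1, ..., K and Q(0) >= 1 - eps, which forces K = O(d^2). *)

Require Import Defs.
From HB Require Import structures.
From mathcomp Require Import all_boot all_order all_algebra.
From mathcomp Require Import reals exp.
From mathcomp Require Import zify ring lra.

Set Implicit Arguments.
Unset Strict Implicit.
Unset Printing Implicit Defensive.

Import Order.TTheory GRing.Theory Num.Theory.

Local Open Scope ring_scope.

(** * Polynomials of low degree on subsets *)

Section LowDegree.
Variables (R : numDomainType) (T : finType).
Implicit Types (f g : {set T} -> R) (d e : nat).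

(** Multilinear polynomials of degree at most [d] in the indicators of the elements of [Z]; the
    monomial of [S] is the indicator of [S \subset Z]. [LowdegExt] makes the predicate independent
    of how a function is written. *)
Inductive lowdeg d : ({set T} -> R) -> Prop :=
| LowdegMono (S : {set T}) of (#|S| <= d)%N :
    lowdeg d (fun Z => (S \subset Z)%:R)
| Lowdeg0 : lowdeg d (fun=> 0)
| LowdegD f g of lowdeg d f & lowdeg d g : lowdeg d (fun Z => f Z + g Z)
| LowdegZ a f of lowdeg d f : lowdeg d (fun Z => a * f Z)
| LowdegExt f g of f =1 g & lowdeg d f : lowdeg d g.

Lemma lowdegC d a : lowdeg d (fun=> a).
Proof.
apply: (@LowdegExt _ (fun Z => a * (set0 \subset Z)%:R)) => [Z|].
  by rewrite sub0set mulr1.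
by apply/LowdegZ/LowdegMono; rewrite cards0.
Qed.

Lemma lowdegB d f g :
  lowdeg d f -> lowdeg d g -> lowdeg d (fun Z => f Z - g Z).
Proof.
move=> fd gd; apply: (@LowdegExt _ (fun Z => f Z + -1 * g Z)) => [Z|].
  by rewrite mulN1r.
exact/LowdegD/LowdegZ.
Qed.

Lemma lowdeg_sum (I : Type) (s : seq I) (F : I -> {set T} -> R) d :
  (forall i, lowdeg d (F i)) -> lowdeg d (fun Z => \sum_(i <- s) F i Z).
Proof.
move=> Fd; elim: s => [|i s IHs].
  by apply: (LowdegExt _ (Lowdeg0 d)) => Z; rewrite big_nil.
by apply: (LowdegExt _ (LowdegD (Fd i) IHs)) => Z; rewrite big_cons.
Qed.

Lemma lowdegM d e f g :
  lowdeg d f -> lowdeg e g -> lowdeg (d + e) (fun Z => f Z * g Z).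
Proof.
move=> + ge; elim=> [S Sd||{}f f' _ IHf _ IHf'|a {}f _ IHf|{}f f' ff' _ IHf].
- elim: ge => [S' Se||{}g g' _ IHg _ IHg'|a {}g _ IHg|{}g g' gg' _ IHg].
  + apply: (@LowdegExt _ (fun Z => (S :|: S' \subset Z)%:R)) => [Z|].
      by rewrite subUset -mulnb natrM.
    exact/LowdegMono/(leq_trans (leq_card_setU _ _))/leq_add.
  + by apply: (LowdegExt _ (Lowdeg0 _)) => Z; rewrite mulr0.
  + by apply: (LowdegExt _ (LowdegD IHg IHg')) => Z; rewrite mulrDr.
  + by apply: (LowdegExt _ (LowdegZ a IHg)) => Z; rewrite mulrCA.
  + by apply: (LowdegExt _ IHg) => Z; rewrite gg'.
- by apply: (LowdegExt _ (Lowdeg0 _)) => Z; rewrite mul0r.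
- by apply: (LowdegExt _ (LowdegD IHf IHf')) => Z; rewrite mulrDl.
- by apply: (LowdegExt _ (LowdegZ a IHf)) => Z; rewrite mulrA.
- by apply: (LowdegExt _ IHf) => Z; rewrite ff'.
Qed.

(** [X] may take values in any type, such as memory contents. Bounding the degree of every function
    of [X] makes local computation free. *)
Definition ldvar d (V : Type) (X : {set T} -> V) :=
  forall phi : V -> R, lowdeg d (phi \o X).

Lemma ldvar_comp d (V W : Type) (h : V -> W) (X : {set T} -> V) :
  ldvar d X -> ldvar d (h \o X).
Proof. by move=> Xd phi; apply: Xd (phi \o h). Qed.

Lemma ldvar_mem (V : Type) (a b : V) (i : T) :
  ldvar 1 (fun Z : {set T} => if i \in Z then a else b).
Proof.
move=> phi; apply: (@LowdegExt _
  (fun Z => phi b + (phi a - phi b) * ([set i] \subset Z)%:R)) => [Z /=|].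
  by rewrite sub1set; case: (i \in Z); rewrite ?mulr1 ?mulr0 ?addr0// addrC subrK.
apply: LowdegD; first exact: lowdegC.
by apply/LowdegZ/LowdegMono; rewrite cards1.
Qed.

(** Expand over the finitely many values [v] of [X]: the indicator of [X Z = v] times [F v Z] has
    degree at most [d + e]. *)
Lemma lowdeg_bind d e (V : eqType) (X : {set T} -> V) (F : V -> {set T} -> R) :
  ldvar d X -> (forall v, lowdeg e (F v)) ->
  lowdeg (d + e) (fun Z => F (X Z) Z).
Proof.
move=> Xd Fe; pose vals := undup (codom X).
apply: (@LowdegExt _ (fun Z => \sum_(v <- vals) (X Z == v)%:R * F v Z)) => [Z|].
  rewrite (bigD1_seq (X Z)) ?undup_uniq ?mem_undup ?codom_f//= eqxx mul1r.
  by rewrite big1 ?addr0// => v /negPf; rewrite eq_sym => ->; rewrite mul0r.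
apply: lowdeg_sum => v; apply: lowdegM => //.
exact: (Xd (fun u => (u == v)%:R)).
Qed.

Lemma ldvar_cat d e (V : eqType) (X Y : {set T} -> seq V) :
  ldvar d X -> ldvar e Y -> ldvar (d + e) (fun Z => X Z ++ Y Z).
Proof.
move=> Xd Ye phi.
by apply: (@lowdeg_bind _ _ _ X (fun u Z => phi (u ++ Y Z))) => // v;
   apply: (Ye (fun y => phi (v ++ y))).
Qed.

(* Inclusion-exclusion over the nonempty blocks, cut off after s of them; it is
   exact wherever at most s blocks are nonempty. *)
Fixpoint truncated (V : eqType) (s : nat) (Xs : seq ({set T} -> seq V))
    (phi : seq V -> R) (Z : {set T}) : R :=
  if Xs is X :: Xs' then
    truncated s Xs' phi Z +
    (if s is s'.+1 then
       if X Z == [::] then 0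
       else truncated s' Xs' (fun u => phi (X Z ++ u)) Z
            - truncated s' Xs' phi Z
     else 0)
  else phi [::].

(** A nonempty block has size at least one and so pays for the unit of [s] that it consumes. At such
    a block the two terms that skip it are both exact and cancel. *)
Lemma truncatedE (V : eqType) s (Xs : seq ({set T} -> seq V)) phi Z :
  (size (flatten [seq X Z | X <- Xs]) <= s)%N ->
  truncated s Xs phi Z = phi (flatten [seq X Z | X <- Xs]).
Proof.
elim: Xs s phi => [//|X Xs IH] s phi /=.
rewrite size_cat; case: s => [|s] le_s.
  rewrite addr0 IH; last exact: leq_trans (leq_addl _ _) le_s.
  by move: le_s; rewrite leqn0 addn_eq0 size_eq0 => /andP[/eqP-> _].
have [XZ0|XZn0] := eqVneq (X Z) [::].
  by rewrite addr0 IH ?XZ0//; apply: leq_trans (leq_addl _ _) le_s.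
have le_s' : (size (flatten [seq Y Z | Y <- Xs]) <= s)%N.
  rewrite -ltnS (leq_trans _ le_s)// -[X in (X < _)%N]add0n ltn_add2r.
  by rewrite lt0n size_eq0.
by rewrite !IH ?leqW// addrC subrK.
Qed.

(** Reading a block costs [d] and lowers [s], while skipping one costs nothing; hence the degree
    does not grow with the length of [r]. *)
Lemma lowdeg_truncated (V : eqType) s (I : Type) (r : seq I)
    (X : I -> {set T} -> seq V) phi d :
  (forall i, ldvar d (X i)) ->
  lowdeg (s * d) (truncated s [seq X i | i <- r] phi).
Proof.
move=> Xd; elim: r s phi => [|i r IH] s phi; first exact: lowdegC.
apply: LowdegD => //; case: s => [|s]; first exact: Lowdeg0.
rewrite mulSn; apply: (@lowdeg_bind _ _ _ (X i) (fun v Z =>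
  if v == [::] then 0 else
  truncated s [seq X j | j <- r] (fun u => phi (v ++ u)) Z
  - truncated s [seq X j | j <- r] phi Z)) => // v.
by case: eqP => _; [apply: Lowdeg0 | apply: lowdegB].
Qed.

(** The bound ignores the number of blocks, which is what allows arbitrarily many machines. *)
Lemma ldvar_flatten (V : eqType) s (I : Type) (r : seq I)
    (X : I -> {set T} -> seq V) d :
  (forall i, ldvar d (X i)) ->
  (forall Z, (size (flatten [seq X i Z | i <- r]) <= s)%N) ->
  ldvar (s * d) (fun Z => flatten [seq X i Z | i <- r]).
Proof.
move=> Xd le_s phi.
apply: (@LowdegExt _ (truncated s [seq X i | i <- r] phi)) => [Z|].
  have E : [seq Y Z | Y <- [seq X i | i <- r]] = [seq X i Z | i <- r].
    by rewrite -map_comp.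
  by rewrite truncatedE E.
exact: lowdeg_truncated.
Qed.

End LowDegree.
Arguments ldvar {R T} d {V} X.

(** * The degree of a protocol *)

Lemma map_filter_flatten (U V : Type) (P : pred U) (g : U -> V) (s : seq U) :
  [seq g x | x <- s & P x] =
  flatten [seq (if P x then [:: g x] else [::]) | x <- s].
Proof. by elim: s => //= x s <-; case: (P x). Qed.

Lemma zip_mapr (U V W : Type) (f : V -> W) (s : seq U) (t : seq V) :
  zip s (map f t) = [seq (p.1, f p.2) | p <- zip s t].
Proof. by elim: s t => [|x s IHs] [|y t] //=; rewrite IHs. Qed.

Section Protocol.
Variables (R : realType) (I : Type) (A : mpc R I) (w : coins A).
Variables (T : finType) (J : Type) (js : seq J) (item : {set T} -> J -> I).
Variables (s r : nat).
Hypothesis item_deg1 :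
  forall j (V : Type) (h : I -> V), ldvar (R := R) 1 (fun Z => h (item Z j)).

Let input Z := [seq item Z j | j <- js].
Hypothesis space : forall Z, within_space w (input Z) s r.

Lemma ldvar_init (i : machine A) : (0 < r)%N ->
  ldvar (R := R) s (fun Z => memory w (input Z) 0 i).
Proof.
move=> r0.
(* Since the placement depends on the item too, each position yields a block of at most one word
   that is a function of its item. *)
have E Z : memory w (input Z) 0 i =
    flatten [seq (if place A p.1 (item Z p.2) == i
                  then [:: load A p.1 (item Z p.2)] else [::])
            | p <- zip (iota 0 (size js)) js].
  rewrite /= /init_memory /input size_map map_filter_flatten.
  by rewrite zip_mapr -map_comp.
suff H : ldvar (R := R) (s * 1) (fun Z =>
    flatten [seq (if place A p.1 (item Z p.2) == i
                  then [:: load A p.1 (item Z p.2)] else [::])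
            | p <- zip (iota 0 (size js)) js]).
  by move=> phi; move: (H phi); rewrite muln1; apply: LowdegExt => Z; rewrite /= -E.
apply: ldvar_flatten => [p|Z].
  exact: (item_deg1 p.2
    (fun x => if place A p.1 x == i then [:: load A p.1 x] else [::])).
by rewrite -E; case: (space Z i) => + _; apply.
Qed.

(** If memories have degree [D], the kept words have degree [D], and the inbox concatenates blocks
    of degree [D] with at most [s] words in all; one round thus turns [D] into [D + s * D]. *)
Lemma ldvar_memory t (i : machine A) : (t < r)%N ->
  ldvar (R := R) (s * s.+1 ^ t) (fun Z => memory w (input Z) t i).
Proof.
elim: t i => [|t IH] i t_r; first by rewrite expn0 muln1; apply: ldvar_init.
have {}IH k := IH k (ltnW t_r).
rewrite expnSr mulnA mulnS; apply: ldvar_cat.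
  exact: (ldvar_comp (keep t w i)) (IH i).
rewrite mulnC; apply: ldvar_flatten => [k|Z].
  exact: (ldvar_comp (fun v => [seq m.2 | m <- send t w k v & m.1 == i])) (IH k).
by case: (space Z i) => _ /(_ t t_r)[].
Qed.

Lemma lowdeg_answer : (0 < r)%N ->
  lowdeg (R := R) (s * s.+1 ^ r.-1) (fun Z => (answer w (input Z) r)%:R).
Proof.
move=> r0; have lt_r : (r.-1 < r)%N by rewrite prednK.
exact: (ldvar_memory (out_machine A) lt_r (fun v => (out w v)%:R)).
Qed.

End Protocol.

(** * Approximate degree of AND *)

Lemma prod_subr_ffact (R : pzRingType) (u t : nat) :
  \prod_(i < t) (u%:R - i%:R : R) = (u ^_ t)%:R.
Proof.
elim: t => [|t IHt]; first by rewrite big_ord0.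
rewrite big_ord_recr /= IHt ffactnSr natrM.
by have [ut|tu] := ltnP u t; [rewrite ffact_small ?mul0r | rewrite natrB].
Qed.

(** For [t <= u] both sides, multiplied by the factorials of [u - t] and [n - u], give the factorial
    of [n]. This turns a count of supersets into ['C(n, u)] times a polynomial in [u]. *)
Lemma bin_ffact_exchange (n t u : nat) : (t <= n)%N -> (u <= n)%N ->
  ('C(n - t, n - u) * n ^_ t = 'C(n, u) * u ^_ t)%N.
Proof.
move=> tn un; have [ut|tu] := ltnP u t.
  by rewrite [u ^_ t]ffact_small// muln0 bin_small//; lia.
have le_nu : (n - u <= n - t)%N by lia.
have e1 := bin_fact un; have e2 := ffact_fact tu; have e3 := ffact_fact tn.
have := bin_fact le_nu; rewrite (_ : (n - t) - (n - u) = u - t)%N => [e4|]; last by lia.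
apply/eqP; rewrite -(eqn_pmul2r (fact_gt0 (u - t))) -(eqn_pmul2r (fact_gt0 (n - u))).
apply/eqP; transitivity (n`!); first by rewrite -e3 -e4; ring.
by rewrite -e1 -e2; ring.
Qed.

(** Complementation sends these sets to the subsets of [~: S] with [#|T| - u] elements. *)
Lemma card_supersets (T : finType) (S : {set T}) (u : nat) : (u <= #|T|)%N ->
  #|[set Z : {set T} | S \subset Z & #|Z| == u]| = 'C(#|T| - #|S|, #|T| - u).
Proof.
move=> uT; rewrite -[(#|T| - #|S|)%N](_ : #|~: S| = _); last first.
  by rewrite -(cardsC S) addKn.
rewrite -cards_draws -(card_imset _ (can_inj (@setCK T))); apply: eq_card => Z.
apply/imsetP/idP => [[Y]|].
  rewrite !inE => /andP[SY /eqP Yu] ->; rewrite setCS SY /=.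
  by rewrite -Yu -(cardsC Y) addKn.
rewrite inE => /andP[ZS /eqP Zu]; exists (~: Z); last by rewrite setCK.
rewrite inE -setCS setCK ZS /=; apply/eqP.
by have := cardsC Z; lia.
Qed.

Lemma size_shift_diff (R : comNzRingType) (P : {poly R}) :
  (size (P - (P \Po ('X + 1)))%R <= (size P).-1)%N.
Proof.
have -> : P - (P \Po ('X + 1)) =
    \sum_(i < size P) P`_i *: ('X^i - ('X + 1) ^+ i).
  rewrite comp_polyE -{1}[P]coefK poly_def -sumrB.
  by apply: eq_bigr => i _; rewrite scalerBr.
apply: (leq_trans (size_sum _ _ _)); apply/bigmax_leqP => i _.
(* A difference of powers factors through ['X - ('X + 1) = -1], and the cofactor has degree at most
   [i - 1]. *)
rewrite subrXX opprD addrA subrr add0r mulN1r.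
apply: (leq_trans (size_scale_leq _ _)); rewrite size_polyN.
apply: (leq_trans (size_sum _ _ _)); apply/bigmax_leqP => j _.
apply: (leq_trans (size_polyMleq _ _)); rewrite size_polyXn.
have := size_poly_exp_leq ('X + 1 : {poly R}) j.
rewrite size_XaddC -[2.-1]/1%N mul1n => size_j.
have arith (a b k c : nat) : (b < a)%N -> (a < c)%N -> (k <= b.+1)%N ->
    (((a.-1 - b).+1 + k).-1 <= c.-1)%N by lia.
exact: arith (ltn_ord j) (ltn_ord i) size_j.
Qed.

(** Induction on [m]: by Pascal's rule the difference of order [m.+1] of [P] is the one of order [m]
    of [P - (P \Po ('X + 1))], whose degree is lower. *)
Lemma finite_difference_eq0 (R : comNzRingType) (P : {poly R}) (m : nat) :
  (size P <= m)%N ->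
  \sum_(j < m.+1) (-1) ^+ j * 'C(m, j)%:R * P.[j%:R] = 0.
Proof.
elim: m P => [|m IH] P sP.
  by rewrite big_ord1 (size_poly_leq0P _ sP) horner0 mulr0.
have /IH : (size (P - (P \Po ('X + 1)))%R <= m)%N.
  by rewrite (leq_trans (size_shift_diff P))//; lia.
under eq_bigr => j _ do rewrite hornerD hornerN horner_comp hornerD hornerX
  hornerC natr1 mulrBr.
rewrite sumrB => E; rewrite big_ord_recl /=.
under eq_bigr => j _ do rewrite /bump /= add1n binS natrD mulrDr mulrDl.
rewrite big_split /= addrA -[RHS]E; congr (_ + _).
  rewrite big_ord_recr /= ['C(m, m.+1)]bin_small// mulr0 mul0r addr0.
  by rewrite [in RHS]big_ord_recl /= !bin0.
rewrite -sumrN; apply: eq_bigr => j _.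
by rewrite exprS mulN1r !mulNr.
Qed.

(** Neighbouring coefficients are compared while moving away from the centre to the left; symmetry
    covers the right half. *)
Lemma leq_bin_central (d j : nat) : ('C(d.*2, j) <= 'C(d.*2, d))%N.
Proof.
have le_central i : (i <= d)%N -> ('C(d.*2, d - i) <= 'C(d.*2, d))%N.
  elim: i => [|i IHi] id; first by rewrite subn0.
  apply: leq_trans (IHi (ltnW id)).
  have := mul_bin_left d.*2 (d - i.+1); rewrite subnSK//.
  by nia.
have [jd|dj] := leqP j d; first by rewrite -(subKn jd) le_central// leq_subr.
have [j2|j2] := leqP j d.*2; last by rewrite bin_small.
rewrite -bin_sub// (_ : d.*2 - j = d - (j - d))%N; last by lia.
by apply: le_central; lia.
Qed.

Lemma sum_inv_squares (R : realFieldType) (d : nat) :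
  \sum_(k < d) (k.+1%:R ^- 2 : R) <= 2.
Proof.
(* The sharper bound closes the induction, as the terms are dominated by a telescoping sum. *)
suff : \sum_(k < d.+1) (k.+1%:R ^- 2 : R) <= 2 - d.+1%:R^-1.
  rewrite big_ord_recr /= => le2; apply: le_trans (_ : 2 - d.+1%:R^-1 <= _).
    by apply: le_trans le2; rewrite lerDl invr_ge0 exprn_ge0.
  by rewrite gerBl invr_ge0.
elim: d => [|d IHd]; first by rewrite big_ord1 expr1n invr1; lra.
rewrite big_ord_recr /=; apply: le_trans (lerD IHd (lexx _)) _.
rewrite -[d.+2%:R]natr1; have : 0 < d.+1%:R :> R by rewrite ltr0n.
move: d.+1%:R => x x0.
rewrite -subr_ge0 (_ : _ - _ = x^-1 * (x + 1)^-1 ^+ 2); last first.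
  by field; rewrite ?expf_neq0//; apply/andP; split; lra.
by rewrite mulr_ge0 ?exprn_ge0 ?invr_ge0//; lra.
Qed.

(** Minsky-Papert symmetrization: over the sets of size [u], the monomial of a [t]-element set
    averages to the ratio of the falling factorials [u ^_ t] and [#|T| ^_ t], a polynomial of degree
    [t] in [u]. *)
Lemma lowdeg_symmetrize (R : numFieldType) (T : finType) d (f : {set T} -> R) :
  lowdeg d f -> exists2 Q : {poly R}, (size Q <= d.+1)%N &
    forall u, (u <= #|T|)%N ->
      Q.[u%:R] * 'C(#|T|, u)%:R = \sum_(Z : {set T} | #|Z| == u) f Z.
Proof.
elim=> [S Sd||{}f g _ [P sP PE] _ [Q sQ QE]|a {}f _ [P sP PE]|{}f g fg _ [P sP PE]].
- have ST := max_card (mem S).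
  exists ((#|T| ^_ #|S|)%:R^-1 *: \prod_(i < #|S|) ('X - (i%:R)%:P)).
    rewrite (leq_trans (size_scale_leq _ _))//.
    rewrite -(big_mkord xpredT (fun i => 'X - (i%:R)%:P)) size_prod_XsubC.
    by rewrite size_iota subn0.
  move=> u uT; rewrite hornerZ horner_prod.
  under eq_bigr => i _ do rewrite hornerXsubC.
  rewrite prod_subr_ffact -mulrA -natrM mulnC -bin_ffact_exchange// natrM mulrCA.
  rewrite mulVf ?mulr1; last by rewrite pnatr_eq0 -lt0n ffact_gt0.
  rewrite -card_supersets// -sum1_card natr_sum.
  rewrite [RHS]big_mkcond [LHS]big_mkcond; apply: eq_bigr => Z _.
  by rewrite inE; case: (S \subset Z) => /=; case: (#|Z| == u).
- exists 0; first by rewrite size_poly0.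
  by move=> u _; rewrite horner0 mul0r big1.
- exists (P + Q); first by rewrite (leq_trans (size_polyD _ _))// geq_max sP.
  by move=> u uT; rewrite hornerD mulrDl PE// QE// big_split.
- exists (a *: P); first exact: leq_trans (size_scale_leq _ _) sP.
  by move=> u uT; rewrite hornerZ -mulrA PE// mulr_sumr.
- exists P => // u uT; rewrite PE//; apply: eq_bigr => Z _; exact: fg.
Qed.

(* Factor Q - Q(1) = (X - 1) S, so that |S(c k^2)| <= 1/(c k^2 - 1).  The 2d-th
   finite difference of S(c (X - d)^2), whose degree is at most 2d - 2, vanishes
   and bounds its middle value S(0) = Q(1) - Q(0). *)
Lemma poly_jump (R : realFieldType) (Q : {poly R}) (c d : nat) :
  (1 < c)%N -> (0 < d)%N -> (size Q <= d.+1)%N ->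
  (forall u, (0 < u <= c * d ^ 2)%N -> 0 <= Q.[u%:R] <= 1) ->
  `|Q.[0] - Q.[1]| <= 4 / (c%:R - 1).
Proof.
move=> c1 d0 sQ Q01.
have /factor_theorem[S QS] : root (Q - Q.[1]%:P) 1.
  by rewrite rootE hornerD hornerN hornerC subrr.
have sS : (size S <= d)%N.
  have [->|S0] := eqVneq S 0; first by rewrite size_poly0.
  have : (size (Q - Q.[1]%:P)%R <= d.+1)%N.
    rewrite (leq_trans (size_polyD _ _))// geq_max sQ size_polyN.
    by rewrite (leq_trans (size_polyC_leq1 _)).
  by rewrite QS size_Mmonic ?monicXsubC// size_XsubC addn2.
have QSE x : Q.[x] - Q.[1] = S.[x] * (x - 1).
  by have := congr1 (horner^~ x) QS; rewrite !hornerE.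
have c1R : 0 < c%:R - 1 :> R by rewrite subr_gt0 ltr1n.
have Sk k : (k < d)%N ->
    `|S.[c%:R * k.+1%:R ^+ 2]| <= (c%:R - 1)^-1 * k.+1%:R ^- 2.
  move=> kd; set x : R := k.+1%:R ^+ 2.
  have x1 : 1 <= x by rewrite exprn_ege1// ler1n.
  have ux : c%:R * x = (c * k.+1 ^ 2)%:R by rewrite natrM natrX.
  have /andP[Q0 Q1] : 0 <= Q.[c%:R * x] <= 1.
    rewrite ux Q01// muln_gt0 expn_gt0 /= leq_mul2l leq_exp2r// kd orbT andbT.
    by rewrite (ltn_trans _ c1).
  have /andP[Q0' Q1'] : 0 <= Q.[1] <= 1.
    by apply: (Q01 1%N); rewrite /= muln_gt0 expn_gt0 d0 (ltn_trans _ c1).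
  have : `|Q.[c%:R * x] - Q.[1]| <= 1 by rewrite ler_norml; lra.
  rewrite QSE normrM -invfM => le1.
  have cx : 0 < (c%:R - 1) * x by rewrite mulr_gt0// (lt_le_trans ltr01).
  (* As [1 <= x], the factor [c%:R * x - 1] is at least [(c%:R - 1) * x]. *)
  rewrite -[leRHS]mul1r ler_pdivlMr// (le_trans _ le1)// ler_wpM2l//.
  by rewrite ger0_norm; nra.
(* The nodes [0, ..., d.*2] are symmetric about [d], where [P] takes the value [S.[0]]. At distance
   [k > 0] from [d] the value is that of [S] at [c * k ^ 2], a point where [Sk] applies. *)
pose P := S \Po (c%:R *: ('X - d%:R%:P) ^+ 2).
have sP : (size P <= d.*2)%N.
  rewrite (leq_trans (size_comp_poly_leq _ _))//.
  have : (size (c%:R *: ('X - d%:R%:P) ^+ 2 : {poly R}) <= 3)%N.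
    rewrite (leq_trans (size_scale_leq _ _))// (leq_trans (size_poly_exp_leq _ _))//.
    by rewrite size_XsubC.
  have arith (a b : nat) : (a <= d -> b <= 3 -> (a.-1 * b.-1).+1 <= d.*2)%N by nia.
  exact: arith.
have PE x : P.[x] = S.[c%:R * (x - d%:R) ^+ 2].
  by rewrite horner_comp !hornerE.
have := finite_difference_eq0 sP.
have mid : (d < d.*2.+1)%N by lia.
rewrite (bigD1 (Ordinal mid))//= => /eqP; rewrite addr_eq0 => /eqP/(congr1 Num.norm).
rewrite normrN !normrM normrX normrN1 expr1n mul1r normr_nat PE subrr expr0n mulr0.
move=> E; have B0 : 0 < 'C(d.*2, d)%:R :> R by rewrite ltr0n bin_gt0; lia.
(* The central binomial coefficient dominates, so dividing by it leaves weights of absolute value at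
   most 1. *)
have {E} leS : `|S.[0]| <= \sum_(j < d.*2.+1 | j != Ordinal mid) `|P.[j%:R]|.
  rewrite -(ler_pM2l B0) E mulr_sumr (le_trans (ler_norm_sum _ _ _))//.
  apply: ler_sum => j _.
  rewrite !normrM normrX normrN1 expr1n mul1r normr_nat ler_wpM2r//.
  by rewrite ler_nat leq_bin_central.
have -> : Q.[0] - Q.[1] = - S.[0] by rewrite QSE sub0r mulrN1.
rewrite normrN (le_trans leS)//.
have -> : \sum_(j < d.*2.+1 | j != Ordinal mid) `|P.[j%:R]| =
    \sum_(k < d) `|S.[c%:R * k.+1%:R ^+ 2]| + \sum_(k < d) `|S.[c%:R * k.+1%:R ^+ 2]|.
  rewrite -(big_mkord (fun j => j != d) (fun j => `|P.[j%:R]|)).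
  rewrite (big_cat_nat (n := d))//=; last by lia.
  congr (_ + _).
    rewrite big_nat_rev /= add0n big_mkord; apply: congr_big => // i; last first.
      rewrite PE => _; congr `|S.[_ * _]|.
      by rewrite natrB// addrAC subrr sub0r sqrrN.
    by have := ltn_ord i; lia.
  rewrite (big_ltn_cond (m := d)) ?eqxx//= -[d.+1]add0n big_addn.
  rewrite (_ : d.*2.+1 - d.+1 = d)%N; last by lia.
  rewrite big_mkord; apply: congr_big => // i; first by lia.
  by rewrite PE => _; congr `|S.[_ * _ ^+ 2]|; rewrite addnS -addSn natrD addrK.
(* The constant 4 is this doubling times the bound 2 on the sum of inverse squares. *)
rewrite -mulr2n -[leLHS]mulr_natl.
apply: (@le_trans _ _ (2 * \sum_(k < d) (c%:R - 1)^-1 * k.+1%:R ^- 2)).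
  by rewrite ler_pM2l//; apply: ler_sum => k _; apply: Sk.
rewrite -mulr_sumr [4 / _]mulrC mulrCA ler_pM2l ?invr_gt0//.
by have := sum_inv_squares R d; lra.
Qed.

(** If [#|T|] reached [c * d ^ 2], the symmetrized polynomial would drop by at least [1 - 2 * eps]
    from 0 to 1 while staying in [[0, 1]] at [1, ..., c * d ^ 2], against [poly_jump]. *)
Lemma and_degree_bound (R : realFieldType) (T : finType) (c d : nat) (eps : R)
    (p : {set T} -> R) :
  lowdeg d p -> (1 < c)%N -> (0 < d)%N -> eps <= 1 ->
  1 - eps <= p set0 -> (forall Z, Z != set0 -> 0 <= p Z <= eps) ->
  4 / (c%:R - 1) < 1 - 2 * eps -> (#|T| < c * d ^ 2)%N.
Proof.
move=> pd c1 d0 eps1 p0 pZ lt4; rewrite ltnNge; apply/negP => leT.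
have [Q sQ QE] := lowdeg_symmetrize pd.
have Q0 : Q.[0] = p set0.
  have := QE 0 (leq0n _); rewrite bin0 mulr1 => ->.
  by under eq_bigl => Z do rewrite cards_eq0; rewrite big_pred1_eq.
have Qu u : (0 < u <= c * d ^ 2)%N -> 0 <= Q.[u%:R] <= eps.
  move=> /andP[u0 ud]; have uT := leq_trans ud leT.
  have B0 : 0 < 'C(#|T|, u)%:R :> R by rewrite ltr0n bin_gt0.
  rewrite -(pmulr_lge0 _ B0) -[X in _ && X](ler_pM2r B0) QE//.
  have Z0 (Z : {set T}) : #|Z| == u -> 0 <= p Z <= eps.
    by move=> /eqP Zu; apply: pZ; rewrite -cards_eq0 Zu -lt0n.
  apply/andP; split; first by apply: sumr_ge0 => Z /Z0/andP[].
  rewrite -(card_draws T u) mulr_natr -sumr_const.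
  rewrite [leRHS](eq_bigl (fun Z : {set T} => #|Z| == u)); last first.
    by move=> Z; rewrite inE.
  by apply: ler_sum => Z /Z0/andP[].
have /(_ 1%N) := Qu; rewrite /= muln_gt0 expn_gt0 d0 (ltn_trans _ c1)//=.
move=> /(_ isT)/andP[_ Q1].
have : `|Q.[0] - Q.[1]| <= 4 / (c%:R - 1).
  by apply: (@poly_jump _ _ _ d) => // u /Qu/andP[-> /le_trans]; apply.
by move=> /(le_trans (ler_norm _)); rewrite Q0; lra.
Qed.

(** * Spectral gaps of cliques and stars *)

(** Sylvester's determinant identity, by block elimination of [B] from the right and from the left.
    Powers of [a] avoid division, as [a] will be a polynomial ['X - l%:P]. *)
Lemma det_scalar_add_mulmx (R : comNzRingType) (k r : nat) (a : R)
    (U : 'M[R]_(k, r)) (V : 'M[R]_(r, k)) :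
  a ^+ r * \det (a%:M + U *m V) = a ^+ k * \det (a%:M + V *m U).
Proof.
pose B := block_mx a%:M (- U) V 1%:M.
have <- : \det B = \det (a%:M + U *m V).
  have : \det (B *m block_mx 1%:M 0 (- V) 1%:M) = \det (a%:M + U *m V).
    rewrite mulmx_block !mulmx1 !mulmx0 !add0r !mulmxN !mulNmx opprK !mul1mx subrr.
    by rewrite det_ublock det1 mulr1.
  by rewrite det_mulmx det_lblock !det1 !mulr1.
have : \det (block_mx 1%:M 0 (- V) a%:M *m B) = a ^+ k * \det (a%:M + V *m U).
  rewrite mulmx_block !mul1mx !mul0mx !addr0 !mulNmx !mulmxN opprK !mulmx1.
  by rewrite mul_scalar_mx mul_mx_scalar addNr det_ublock det_scalar addrC.
by rewrite det_mulmx det_lblock det1 mul1r det_scalar.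
Qed.

Lemma det_mx22 (R : comNzRingType) (A : 'M[R]_2) :
  \det A = A 0 0 * A 1 1 - A 0 1 * A 1 0.
Proof.
rewrite (expand_det_row _ 0) !big_ord_recl big_ord0 addr0 /cofactor !det_mx11 !mxE.
rewrite /= expr0 mul1r expr1 mulN1r mulrN.
by congr (A _ _ * A _ _ - A _ _ * A _ _); apply: val_inj.
Qed.

Lemma char_poly_mxE (R : nzRingType) (k : nat) (A : 'M[R]_k) i j :
  char_poly_mx A i j = 'X *+ (i == j) - (A i j)%:P.
Proof. by rewrite !mxE. Qed.

Section Gaps.
Variables (R : realType) (T : finType) (G : sgraph T) (H : {set T}).

Lemma degree_nonadj (x : T) (P : pred T) :
  {in H, forall y, adj G x y = P y} -> degree G H x = #|[set y in H | P y]|.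
Proof.
by move=> GP; apply: eq_card => y; rewrite !inE; case: (boolP (y \in H)) => // /GP->.
Qed.

Lemma normalized_laplacianE i j :
  normalized_laplacian R G H i j = (i == j)%:R -
    (Num.sqrt (degree G H (enum_val i))%:R)^-1 *
    (adj G (enum_val i) (enum_val j))%:R *
    (Num.sqrt (degree G H (enum_val j))%:R)^-1.
Proof.
rewrite /normalized_laplacian. rewrite /inv_sqrt_deg_mx mul_mx_diag mul_diag_mx !mxE.
by rewrite mulrAC.
Qed.

(** The Laplacian is [l] times the identity minus a constant matrix of rank one, so the
    characteristic polynomial reduces to a determinant of size 1. The eigenvalues are 0 once and [l]
    with multiplicity [k.+1]. *)
Lemma spectral_gap_clique :
  (1 < #|H|)%N -> {in H &, forall x y, adj G x y = (x != y)} ->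
  exists2 g : R, is_spectral_gap G H g & 1 <= g.
Proof.
move=> H1 GH; have [k Hk] : exists k, #|H| = k.+2.
  by case: #|H| H1 => [|[|k]]//; exists k.
have k1 : k.+1%:R != 0 :> R by rewrite pnatr_eq0.
pose l : R := k.+2%:R / k.+1%:R.
have lE : l = 1 + k.+1%:R^-1 by rewrite /l -natr1 mulrDl divff// mul1r addrC.
have degH x : x \in H -> degree G H x = k.+1.
  move=> xH; rewrite (@degree_nonadj _ (fun y => y != x)); last first.
    by move=> y yH; rewrite GH// eq_sym.
  have := cardsD1 x H; rewrite xH Hk add1n => -[->].
  by apply: eq_card => y; rewrite !inE andbC.
have l1 : 1 <= l by rewrite ler_pdivlMr ?mul1r ?ltr0n// ler_nat.
exists l => //; exists (0 :: nseq k.+1 l).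
split; [split | by rewrite /= size_nseq | by []].
  rewrite /= (le_trans ler01)//=.
  by elim: (k) => //= k' ->; rewrite lexx.
pose U : 'cV[{poly R}]_#|H| := const_mx (k.+1%:R^-1)%:P.
pose V : 'rV[{poly R}]_#|H| := const_mx 1.
have -> : char_poly (normalized_laplacian R G H) =
    \det (('X - l%:P)%:M + U *m V).
  congr (\det _); apply/matrixP => i j.
  rewrite [RHS]mxE char_poly_mxE normalized_laplacianE !mxE big_ord1 !mxE mulr1.
  rewrite !degH ?enum_valP// GH ?enum_valP//.
  rewrite (inj_eq enum_val_inj).
  have [_|_] /= := eqVneq i j.
    rewrite !mulr1n mulr0 mul0r subr0 lE polyCD opprD addrA subrK.
    by rewrite polyC1.
  rewrite !mulr0n !add0r mulr1 -invfM -expr2 sqr_sqrtr//.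
  by rewrite polyCN opprK.
have a0 : 'X - l%:P != 0 by rewrite polyXsubC_eq0.
apply: (mulfI a0); rewrite -[X in X * _]expr1 det_scalar_add_mulmx det_mx11.
rewrite !mxE mulr1n (eq_bigr (fun=> (k.+1%:R^-1)%:P)); last first.
  by move=> i _; rewrite !mxE mul1r.
rewrite sumr_const card_ord Hk -polyCMn (_ : _ *+ k.+2 = l) ?subrK; last first.
  by rewrite /l mulr_natl.
rewrite big_cons subr0 big_nseq iter_mulr_1 exprS.
by rewrite -mulrA; congr (_ * _); rewrite mulrC.
Qed.

(** With [e] the indicator of the centre and [q] the normalized indicator of the leaves, the
    Laplacian is the identity minus the rank-two matrix [e q^T + q e^T]. The eigenvalues are 0, 1
    with multiplicity [m], and 2. *)
Lemma spectral_gap_star (h : T) :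
  h \in H -> (1 < #|H|)%N ->
  {in H &, forall x y, adj G x y = (x != y) && ((x == h) || (y == h))} ->
  exists2 g : R, is_spectral_gap G H g & 1 <= g.
Proof.
move=> hH H1 GH; have [m Hm] : exists m, #|H| = m.+2.
  by case: #|H| H1 => [|[|m]]//; exists m.
have cardHh : #|H :\ h| = m.+1 by have := cardsD1 h H; rewrite hH Hm add1n => -[].
have degh : degree G H h = m.+1.
  rewrite (@degree_nonadj _ (fun y => y != h)) -?cardHh; last first.
    by move=> y yH; rewrite GH// eqxx andbT eq_sym.
  by apply: eq_card => y; rewrite !inE andbC.
have degx x : x \in H -> x != h -> degree G H x = 1%N.
  move=> xH xh; rewrite (@degree_nonadj _ (pred1 h)) -?(cards1 h).
    by apply: eq_card => y; rewrite !inE; case: eqP => [->|]; rewrite ?hH ?andbF.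
  move=> y yH; rewrite GH// (negPf xh) /=.
  by case: (y =P h) => [->|_]; rewrite ?xh ?andbF.
pose s := 0 :: rcons (nseq m 1) 2 : seq R.
(* The entry is 1, or 2 when [m = 0] and the star is a single edge. *)
exists s`_1; last by rewrite /s /=; case: (m) => //=; rewrite ler1n.
exists s; split; [split | by rewrite /s /= size_rcons | by []].
  rewrite /s /=; case: m {Hm cardHh degh s} => [|m] /=; first by rewrite ler0n.
  by rewrite ler01 /=; elim: m => [|m IHm] /=; rewrite ?lexx ?ler1n//.
pose e (x : T) : R := (x == h)%:R.
pose q (x : T) : R := (x != h)%:R / Num.sqrt m.+1%:R.
pose U : 'M[{poly R}]_(#|H|, 2) :=
  \matrix_(i, j) (if j == 0 then e (enum_val i) else q (enum_val i))%:P.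
pose V : 'M[{poly R}]_(2, #|H|) :=
  \matrix_(i, j) (if i == 0 then q (enum_val j) else e (enum_val j))%:P.
have -> : char_poly (normalized_laplacian R G H) = \det (('X - 1%:P)%:M + U *m V).
  congr (\det _); apply/matrixP => i j.
  rewrite [RHS]mxE char_poly_mxE normalized_laplacianE !mxE.
  rewrite big_ord_recl big_ord1 !mxE /= /e /q -!polyCM -polyCD.
  rewrite GH ?enum_valP// (inj_eq enum_val_inj).
  have [->|ij] /= := eqVneq i j.
    rewrite mulr0 mul0r subr0 !mulr1n polyC1.
    by case: eqP => _ /=; rewrite !(mul0r, mulr0, addr0).
  have xy : enum_val i != enum_val j by rewrite (inj_eq enum_val_inj).
  rewrite !mulr0n add0r sub0r polyCN opprK add0r; congr (_%:P).
  have [xh|xh] /= := eqVneq (enum_val i) h; have [yh|yh] /= := eqVneq (enum_val j) h.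
  - by rewrite xh yh eqxx in xy.
  - rewrite xh degh degx ?enum_valP// sqrtr1 invr1 !mulr1 mul0r mul0r addr0.
    by rewrite !mul1r.
  - rewrite yh degh degx ?enum_valP// sqrtr1 invr1 !mul1r !mul0r mulr1.
    by rewrite add0r.
  - by rewrite !(mulr0, mul0r, addr0).
have sum_enum (F : T -> R) : \sum_(i < #|H|) F (enum_val i) = \sum_(x in H) F x.
  by rewrite [RHS]big_enum_val.
have ee : \sum_(x in H) e x * e x = 1.
  rewrite (bigD1 h)//= /e eqxx mulr1 big1 ?addr0// => x /andP[_ /negPf->].
  by rewrite mulr0.
have eq0 : \sum_(x in H) e x * q x = 0.
  by rewrite big1// => x _; rewrite /e /q; case: eqP; rewrite /= !(mul0r, mulr0).
have qq : \sum_(x in H) q x * q x = 1.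
  rewrite (bigD1 h)//= /q eqxx /= !mul0r add0r.
  rewrite (eq_bigr (fun=> m.+1%:R^-1)) => [|x /andP[_ ->]]; last first.
    by rewrite mul1r -invfM -expr2 sqr_sqrtr.
  rewrite sumr_const (_ : #|_| = m.+1); last first.
    by rewrite -cardHh; apply: eq_card => x; rewrite !inE andbC.
  by rewrite -[LHS]mulr_natr mulVf// pnatr_eq0.
have VU i j : (V *m U) i j = (\sum_(x in H)
    (if i == 0 then q x else e x) * (if j == 0 then e x else q x))%:P.
  rewrite -sum_enum rmorph_sum /= mxE.
  by apply: eq_bigr => k _; rewrite !mxE polyCM.
have a0 : ('X - 1%:P) ^+ 2 != 0 :> {poly R} by rewrite expf_neq0// polyXsubC_eq0.
apply: (mulfI a0); rewrite det_scalar_add_mulmx.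
(* As [e] and [q] are orthonormal, [V *m U] is the swap matrix and the determinant is
   [('X - 1) ^+ 2 - 1]. *)
have -> : \det (('X - 1%:P)%:M + V *m U) = ('X - 0%:P) * ('X - 2%:P).
  have DE i j : (('X - 1%:P)%:M + V *m U) i j = ('X - 1%:P) *+ (i == j) + (V *m U) i j.
    by rewrite mxE; congr (_ + _); rewrite mxE.
  rewrite det_mx22 !DE !VU /= ee qq eq0.
  under eq_bigr => x _ do rewrite mulrC.
  rewrite eq0 !mulr1n !mulr0n.
  ring.
rewrite big_cons -cats1 big_cat big_seq1 big_nseq iter_mulr_1 Hm -addn2 exprD.
by rewrite /= -mulrA [LHS]mulrCA; congr (_ * _); rewrite mulrCA.
Qed.
End Gaps.

(** * The hard graphs *)

Section HardGraph.
Local Open Scope nat_scope.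
Variables (m K : nat).
Hypothesis Km : (3 * K < m)%N.
Implicit Types (Z : {set 'I_K}) (u v : 'I_m.+1).

Definition hub : 'I_m.+1 := ord_max.

(** Gadget [i] consists of the vertices [3 * i], [3 * i + 1] and [3 * i + 2]. Vertices from [3 * K]
    on, the hub among them, are never detached. *)
Definition detached Z v := [exists i in Z, v %/ 3 == i :> nat].

Definition gadget_rel Z : rel 'I_m.+1 := fun u v => (u != v) &&
  (if detached Z u || detached Z v then u %/ 3 == v %/ 3 :> nat
   else (u == hub) || (v == hub)).

Lemma gadget_sym Z : symmetric (gadget_rel Z).
Proof.
move=> u v; rewrite /gadget_rel eq_sym orbC [(_ %/ 3 == _)%N]eq_sym.
by rewrite [(u == hub) || _]orbC.
Qed.

Lemma gadget_irr Z : irreflexive (gadget_rel Z).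
Proof. by move=> u; rewrite /gadget_rel eqxx. Qed.

Definition gadget_graph Z := SGraph (gadget_sym Z) (gadget_irr Z).

Lemma detached_ltn Z v : detached Z v -> (v %/ 3 < K)%N.
Proof. by case/existsP => i /andP[_ /eqP->]. Qed.

Lemma detached_hub Z : detached Z hub = false.
Proof. by apply/negbTE/negP => /detached_ltn /=; lia. Qed.

Lemma detached_block Z u v : (u %/ 3 = v %/ 3)%N -> detached Z u = detached Z v.
Proof. by rewrite /detached => ->. Qed.

Lemma gadget_detached Z u v : gadget_rel Z u v -> detached Z u = detached Z v.
Proof.
case/andP => _; case: ifPn => [_ /eqP/detached_block //|].
by rewrite negb_or => /andP[/negPf-> /negPf->].
Qed.

Lemma gadget_connect_sym Z : connect_sym (gadget_rel Z).
Proof. exact/sym_connect_sym/gadget_sym. Qed.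

Lemma connect_detached Z u v :
  connect (gadget_rel Z) u v -> detached Z u = detached Z v.
Proof.
have closed_det : closed (gadget_rel Z) (detached Z).
  by move=> x y /gadget_detached; rewrite -!topredE.
by move/(closed_connect closed_det); rewrite -!topredE.
Qed.

Lemma connect_hub Z u : ~~ detached Z u -> connect (gadget_rel Z) u hub.
Proof.
move=> du; have [->|uh] := eqVneq u hub; first exact: connect0.
by apply: connect1; rewrite /gadget_rel uh (negPf du) detached_hub eqxx orbT.
Qed.

Lemma component_attached Z v : ~~ detached Z v ->
  component (gadget_graph Z) v = [set u | ~~ detached Z u].
Proof.
move=> dv; apply/setP => u; rewrite !inE /=; apply/idP/idP.
  by move/connect_detached => <-.
move=> du; apply: connect_trans (connect_hub dv) _.
by rewrite gadget_connect_sym connect_hub.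
Qed.

Lemma component_detached Z v : detached Z v ->
  component (gadget_graph Z) v = [set u : 'I_m.+1 | u %/ 3 == v %/ 3 :> nat].
Proof.
move=> dv; apply/setP => u; rewrite !inE /=; apply/idP/eqP => [|uv].
  pose B := [pred x : 'I_m.+1 | x %/ 3 == v %/ 3 :> nat].
  have closed_B : closed (gadget_rel Z) B.
    apply: (intro_closed (gadget_connect_sym Z)) => x y + /eqP xv.
    rewrite /gadget_rel (detached_block Z xv) dv xv => /andP[_ /eqP vy].
    by rewrite inE /= vy.
  by move/(closed_connect closed_B); rewrite !inE eqxx => /esym/eqP.
have [->|vu] := eqVneq u v; first exact: connect0.
by apply: connect1; rewrite /gadget_rel eq_sym vu dv uv eqxx.
Qed.

(** Orients every edge away from its owner: cyclically around a detached triangle, and from a leaf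
    to the hub. *)
Definition gadget_succ Z v : 'I_m.+1 :=
  if detached Z v then inord (3 * (v %/ 3) + (v %% 3).+1 %% 3) else hub.

Lemma gadget_succ_val Z v : detached Z v ->
  gadget_succ Z v = (3 * (v %/ 3) + (v %% 3).+1 %% 3)%N :> nat.
Proof.
move=> dv; rewrite /gadget_succ dv inordK//.
by have := detached_ltn dv; lia.
Qed.

Lemma gadget_succ_block Z v : detached Z v -> (gadget_succ Z v %/ 3 = v %/ 3)%N.
Proof. by move=> dv; rewrite gadget_succ_val//; lia. Qed.

Lemma gadget_succ_neq Z v : detached Z v -> gadget_succ Z v != v.
Proof. by move=> dv; apply/eqP => /(congr1 val) /=; rewrite gadget_succ_val//; lia. Qed.

Lemma gadget_rel_succ Z v : v != hub -> gadget_rel Z v (gadget_succ Z v).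
Proof.
move=> vh; have [dv|dv] := boolP (detached Z v).
  by rewrite /gadget_rel dv eq_sym gadget_succ_neq// gadget_succ_block/=.
by rewrite /gadget_rel /gadget_succ (negPf dv) vh detached_hub eqxx orbT.
Qed.

Definition gadget_edges Z : seq {set 'I_m.+1} :=
  [seq [set v; gadget_succ Z v] | v <- enum (predC1 hub)].

(** Two owners of one edge would be successors of each other, impossible on a 3-cycle and for a leaf
    and the hub. *)
Lemma gadget_edges_uniq Z : uniq (gadget_edges Z).
Proof.
rewrite map_inj_in_uniq ?enum_uniq// => u v.
rewrite !mem_enum !inE => uh vh E.
have : u \in [set v; gadget_succ Z v] by rewrite -E set21.
have : v \in [set u; gadget_succ Z u] by rewrite E set21.
rewrite !inE => /orP[/eqP->//|/eqP v_u] /orP[/eqP->//|/eqP u_v].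
have [du|du] := boolP (detached Z u); last first.
  by move: vh; rewrite v_u /gadget_succ (negPf du) eqxx.
have dv : detached Z v by rewrite v_u (detached_block Z (gadget_succ_block du)).
have := congr1 val u_v; have := congr1 val v_u; rewrite /= !gadget_succ_val//.
by lia.
Qed.

Lemma mem_gadget_edges Z : gadget_edges Z =i edge_set (gadget_graph Z).
Proof.
move=> e; rewrite inE; apply/mapP/existsP => [[v]|[u /existsP[v /andP[uv /eqP->]]]].
  rewrite mem_enum inE => vh ->; exists v; apply/existsP; exists (gadget_succ Z v).
  by rewrite eqxx andbT; apply: gadget_rel_succ.
(* Every edge is owned by an endpoint: of two distinct residues modulo 3 one cyclically follows the
   other, and a hub edge belongs to its leaf. *)
wlog Q : u v uv / (u != hub) && (gadget_succ Z u == v).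
  move=> H; suff [Q|Q] : (u != hub) && (gadget_succ Z u == v) \/
      (v != hub) && (gadget_succ Z v == u).
    exact: H.
    by rewrite setUC; apply: H => //; rewrite /= gadget_sym.
  move: uv => /= /andP[neq_uv]; case: ifPn => [|].
    move=> duv /eqP bl; have du : detached Z u.
      by case/orP: duv => //; rewrite (detached_block Z bl).
    have dv : detached Z v by rewrite -(detached_block Z bl).
    have uh : u != hub by apply: contraTneq du => ->; rewrite detached_hub.
    have vh : v != hub by apply: contraTneq dv => ->; rewrite detached_hub.
    rewrite uh vh -!val_eqE /= !gadget_succ_val//.
    move: neq_uv; rewrite -val_eqE /=; lia.
  rewrite negb_or /gadget_succ => /andP[/negPf-> /negPf->] uvh.
  case/orP: uvh neq_uv => /eqP->; rewrite eqxx; last by left; rewrite andbT.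
  by move=> hv; right; rewrite andbT eq_sym.
move: Q => /andP[uh /eqP<-]; exists u => //.
by rewrite mem_enum.
Qed.

Lemma perm_gadget_edges Z :
  perm_eq (gadget_edges Z) (enum (edge_set (gadget_graph Z))).
Proof.
apply: uniq_perm; rewrite ?gadget_edges_uniq ?enum_uniq// => e.
by rewrite mem_gadget_edges mem_enum.
Qed.

Lemma card_gadget_edges Z : #|edge_set (gadget_graph Z)| = m.
Proof.
rewrite cardE -(perm_size (perm_gadget_edges Z)) size_map -cardE cardC1.
by rewrite card_ord.
Qed.

Lemma connected_gadget Z : connected (gadget_graph Z) = (Z == set0).
Proof.
apply/forallP/eqP => [conn|-> u]; last first.
  have nd x : ~~ detached set0 x.
    by apply/negP => /existsP[i]; rewrite inE.
  apply/forallP => v; apply: connect_trans (connect_hub (nd u)) _.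
  by rewrite gadget_connect_sym connect_hub.
apply/setP => i; rewrite inE; apply/negP => iZ.
have i3 : (3 * i < m.+1)%N by have := ltn_ord i; lia.
have /forallP/(_ hub)/connect_detached := conn (Ordinal i3).
rewrite detached_hub => /negbT/negP; apply; apply/existsP; exists i.
by rewrite iZ /= mulKn.
Qed.

Lemma gadget_promise (R : realType) (C gamma : R) Z :
  (1 <= C)%R -> (gamma <= 1)%R -> expander_conn_promise C gamma (gadget_graph Z).
Proof.
move=> C1 gamma1; split.
  rewrite card_gadget_edges (@le_trans _ _ m.+1%:R%R) ?ler_nat//.
  by rewrite ler_peMl.
move=> v.
suff [g Hg g1] : exists2 g : R,
    is_spectral_gap (gadget_graph Z) (component (gadget_graph Z) v) g & (1 <= g)%R.
  by exists g => //; apply: le_trans g1.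
have [dv|dv] := boolP (detached Z v).
  rewrite component_detached//; apply: spectral_gap_clique.
    apply/card_gt1P; exists v; exists (gadget_succ Z v).
    by rewrite !inE gadget_succ_block// eqxx eq_sym gadget_succ_neq.
  move=> x y; rewrite !inE => /eqP xv /eqP yv.
  by rewrite /= /gadget_rel (detached_block Z xv) dv xv yv eqxx andbT.
rewrite component_attached//; apply: (@spectral_gap_star _ _ _ _ hub).
- by rewrite inE detached_hub.
(* Vertex [3 * K] is a leaf for every [Z], so the component of the hub always has a second
   eigenvalue. *)
- have K3 : (3 * K < m.+1)%N by lia.
  apply/card_gt1P; exists hub; exists (Ordinal K3).
  rewrite !inE detached_hub -val_eqE /= ; split=> //; last by lia.
  by apply/negP => /detached_ltn /=; lia.
- move=> x y; rewrite !inE => /negPf dx /negPf dy.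
  by rewrite /= /gadget_rel dx dy.
Qed.

(** The edge takes at most two values, selected by whether gadget [v %/ 3] is in [Z]; it is constant
    when there is no such gadget. *)
Lemma ldvar_gadget_edge (R : realType) v (V : Type) (h : {set 'I_m.+1} -> V) :
  ldvar (R := R) 1 (fun Z => h [set v; gadget_succ Z v]).
Proof.
have [vK|vK] := ltnP (v %/ 3) K; last first.
  move=> phi; apply: (LowdegExt _ (lowdegC _ _ (phi (h [set v; hub])))) => Z /=.
  by rewrite /gadget_succ; case: ifP => // /detached_ltn; lia.
pose w : 'I_m.+1 := inord (3 * (v %/ 3) + (v %% 3).+1 %% 3).
move=> phi; have := ldvar_mem (R := R) (h [set v; w]) (h [set v; hub]) (Ordinal vK) phi.
apply: LowdegExt => Z /=; rewrite /gadget_succ.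
have -> : detached Z v = (Ordinal vK \in Z); last by case: ifP.
apply/existsP/idP => [[i /andP[iZ /eqP vi]]|vZ].
  by rewrite (_ : Ordinal vK = i)//; apply: val_inj.
by exists (Ordinal vK); rewrite vZ /=.
Qed.

End HardGraph.

(** * From the degree bound to the bound on rounds *)

Lemma expander_conn_size_bound (R : realType) (C gamma eps : R) (c n s r : nat)
    (A : mpc R {set 'I_n}) :
  1 <= C -> gamma <= 1 -> eps <= 1 -> (1 < c)%N ->
  4 / (c%:R - 1) < 1 - 2 * eps ->
  (1 < s)%N -> (0 < r)%N -> solves_expander_conn C gamma eps s r A ->
  (n <= 8 * c * s ^ (4 * r))%N.
Proof.
move=> C1 gamma1 eps1 c1 c_eps s1 r0.
case: n A => [//|m] A A_solves.
have [m2|m2] := ltnP m 2.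
  have : (0 < s ^ (4 * r))%N by rewrite expn_gt0 (ltn_trans _ s1).
  by move: (s ^ _)%N; nia.
pose K := (m.-1 %/ 3)%N.
have Km : (3 * K < m)%N by rewrite /K; lia.
have promise Z := gadget_promise Km Z C1 gamma1.
have solved Z := A_solves _ _ (promise Z) (perm_gadget_edges Km Z).
pose p (Z : {set 'I_K}) : R :=
  \sum_(w : coins A) mass w * (answer w (gadget_edges m Z) r)%:R.
pose d := (s * s.+1 ^ r.-1)%N.
have p_deg : lowdeg d p.
  have answer_deg (w : coins A) : lowdeg (R := R) d
      (fun Z : {set 'I_K} => (answer w (gadget_edges m Z) r)%:R).
    apply: (@lowdeg_answer _ _ A w _ _ (enum (predC1 (hub m)))
      (fun Z v => [set v; gadget_succ Z v]) s r) => //.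
      by move=> v V h; apply: ldvar_gadget_edge.
    by move=> Z; case: (solved Z).
  by apply: lowdeg_sum => w; apply: LowdegZ.
have err (Z : {set 'I_K}) :
    \sum_(w : coins A | answer w (gadget_edges m Z) r != (Z == set0)) mass w
    <= eps.
  by case: (solved Z) => _; rewrite connected_gadget.
(* [1 - p set0] is the mass of the rejecting coins, which are the erring ones on a connected
   graph. *)
have p0 : 1 - eps <= p set0.
  rewrite lerBlDr -lerBlDl -(mass_sum1 A) (le_trans _ (err set0))//.
  rewrite /p -sumrB [leRHS]big_mkcond; apply: ler_sum => w _.
  by rewrite eqxx; case: answer => /=; rewrite ?mulr1 ?mulr0 ?subrr ?subr0.
have pZ (Z : {set 'I_K}) : Z != set0 -> 0 <= p Z <= eps.
  move=> /negPf Z0; apply/andP; split.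
    by apply: sumr_ge0 => w _; rewrite mulr_ge0 ?mass_ge0.
  rewrite (le_trans _ (err Z))// [leRHS]big_mkcond; apply: ler_sum => w _.
  by rewrite Z0; case: answer; rewrite /= ?mulr1 ?mulr0.
have d0 : (0 < d)%N by rewrite muln_gt0 expn_gt0 (ltn_trans _ s1).
have := and_degree_bound p_deg c1 d0 eps1 p0 pZ c_eps; rewrite card_ord => K_lt.
(* Uses [s.+1 <= s ^ 2], valid since [1 < s]. *)
have le_d : (d <= s ^ (2 * r))%N.
  apply: leq_trans (_ : s.+1 ^ r <= _)%N.
    by rewrite -[X in (_ ^ X)%N](prednK r0) expnS leq_mul2r leqnSn orbT.
  by rewrite expnM leq_exp2r//; nia.
have le_d2 : (d ^ 2 <= s ^ (4 * r))%N.
  by rewrite (_ : 4 * r = 2 * r * 2)%N ?expnM ?leq_exp2r// -?expnM//; lia.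
have d20 : (0 < d ^ 2)%N by rewrite expn_gt0 d0.
(* [K < c * d ^ 2] and [m.-1 < 3 * K.+1] give [m.+1 <= 3 * (c * d ^ 2) + 1]; the factor 8 leaves
   room. *)
apply: leq_trans (_ : 8 * (c * d ^ 2) <= _)%N.
  by move: K_lt; rewrite /K; move: (c * _)%N; lia.
by rewrite -mulnA !leq_mul2l le_d2 orbT.
Qed.

Theorem theorem4 (R : realType) :
  exists C0 gamma0 : R, [/\ 0 < C0, 0 < gamma0 &
    forall C gamma eps : R,
      C0 <= C -> 0 < gamma -> gamma <= gamma0 -> 0 <= eps -> eps < 2^-1 ->
      exists (c : R) (n0 : nat), 0 < c /\
        forall (n s r : nat) (A : mpc R {set 'I_n}),
          (n0 <= n)%N -> (1 < s)%N -> (0 < r)%N ->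
          solves_expander_conn C gamma eps s r A ->
          c * (ln (n%:R : R) / ln (s%:R : R)) <= r%:R].
Proof.
(* The hard graphs have fewer edges than vertices and all gaps at least 1, so both thresholds can be
   1. *)
exists 1, 1; split => // C gamma eps C1 gamma0 gamma1 eps0 eps_half.
have e0 : 0 < 1 - 2 * eps by lra.
have x0 : 0 <= 4 / (1 - 2 * eps) by rewrite divr_ge0// ltW.
(* Chosen so that the possible jump [4 / (c%:R - 1)] falls below the required one, [1 - 2 * eps]. *)
pose c := (Num.bound (4 / (1 - 2 * eps))).+1.
have c_gt : 4 / (1 - 2 * eps) < c%:R - 1.
  by rewrite -[X in _ < X - _]natr1 addrK; apply: archi_boundP.
have c1 : (1 < c)%N.
  by rewrite -(ltr_nat R) -subr_gt0; apply: le_lt_trans c_gt.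
have c_eps : 4 / (c%:R - 1) < 1 - 2 * eps.
  by rewrite ltr_pdivrMr ?(le_lt_trans x0)// mulrC -ltr_pdivrMr.
(* Squaring [n <= 8 * c * s ^ (4 * r)] and using [(8 * c) ^ 2 <= n] to cancel one factor [n] gives
   [n <= s ^ (8 * r)], whence the constant [8^-1] after taking logarithms. *)
exists (8^-1), ((8 * c) ^ 2)%N; split=> [|n s r A n_large s1 r0 A_solves].
  by rewrite invr_gt0.
have eps1 : eps <= 1 by lra.
have n_le := expander_conn_size_bound C1 gamma1 eps1 c1 c_eps s1 r0 A_solves.
have n0 : (0 < n)%N by apply: leq_trans n_large; rewrite expn_gt0 muln_gt0.
have n_le_pow : (n <= s ^ (8 * r))%N.
  rewrite -(leq_pmul2l n0) (leq_trans (leq_mul n_le n_le))//.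
  rewrite mulnACA -expnD -mulnn in n_large *.
  by rewrite (_ : 4 * r + 4 * r = 8 * r)%N ?leq_mul2r ?n_large ?orbT//; lia.
have lns : 0 < ln s%:R :> R by rewrite ln_gt0// ltr1n.
rewrite mulrA ler_pdivrMr// mulrC ler_pdivrMr//.
have : ln n%:R <= ln (s ^ (8 * r))%:R :> R.
  by rewrite ler_ln ?posrE ?ltr0n ?ler_nat// (leq_trans n0).
rewrite natrX lnXn ?ltr0n ?(ltn_trans _ s1)// -[leRHS]mulr_natl natrM.
by lra.
Qed.
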